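(* Assume the following conjectural statement of Manes holds: if $\phi\in\mathbb{Q}(z)$ is a rational map of degree $2$ with $\mathrm{Aut}(\phi)\cong C_2$, then $\phi$ has no rational periodic point of exact period $N>4$. Let $a,b\in\mathbb{Q}^\times$. There exist infinitely many pairs $(t_1,t_2)\in\mathbb{Q}^\times\times\mathbb{Q}^\times$ such that $a$ and $b$ are both periodic points of $\phi_{t_1,t_2}(z)=t_1z+\frac{t_2}{z}$ if and only if $a^2=b^2$.
   Context: A rational map is regarded as a self-map of $\mathbb{P}^1$; in particular $\phi_{t_1,t_2}(0)=\infty$ and $\phi_{t_1,t_2}(\infty)=\infty$. A point $P$ is periodic for $\phi$ if $\phi^n(P)=P$ for some $n>0$, where $\phi^n$ is the $n$-fold iterate; the smallest such $n$ is the exact period of $P$. Periodic points are understood to be finite. For a rational map $\phi$ over $\mathbb{Q}$, $\mathrm{Aut}(\phi)=\{f\in\mathrm{PGL}_2(\overline{\mathbb{Q}}): f^{-1}\circ\phi\circ f=\phi\}$, and $C_2$ is the cyclic group of order $2$. *)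

(* Defs.v *)
From HB Require Import structures.
From mathcomp Require Import all_boot all_order all_fingroup all_algebra.
From mathcomp Require Import all_field fraction.
From mathcomp Require Import classical_sets cardinality.

Set Implicit Arguments.
Unset Strict Implicit.
Unset Printing Implicit Defensive.

Import GRing.Theory.
Local Open Scope ring_scope.
Local Open Scope quotient_scope.

(* [Some x] is the finite point x; [None] is the point at infinity. *)
Definition P1 (K : Type) : Type := option K.

Section RationalMaps.
Variable K : fieldType.
Implicit Types (p q : {poly K}) (phi : {fraction {poly K}}).

(* Numerator and denominator in lowest terms. They are determined up to a
   common nonzero constant factor, on which nothing below depends. *)
Definition numer phi : {poly K} :=
  let r := generic_quotient.repr phi in \n_r %/ gcdp \n_r \d_r.
Definition denom phi : {poly K} :=
  let r := generic_quotient.repr phi in \d_r %/ gcdp \n_r \d_r.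

Definition rat_degree phi : nat :=
  (maxn (size (numer phi)) (size (denom phi))).-1.

(* The self-map [x : y] |-> [y^d p(x/y) : y^d q(x/y)] of P^1, where
   d = max (deg p) (deg q), for coprime p and q. *)
Definition P1_eval p q (P : P1 K) : P1 K :=
  let d := (maxn (size p) (size q)).-1 in
  let: (u, v) := if P is Some x then (p.[x], q.[x]) else (p`_d, q`_d) in
  if v == 0 then None else Some (u / v).

Definition ratmap phi : P1 K -> P1 K := P1_eval (numer phi) (denom phi).

End RationalMaps.

Section PGL2.
Variable K : fieldType.

Record GL2 := MkGL2 { GL2val :> 'M[K]_2; GL2P : GL2val \is a GRing.unit }.
HB.instance Definition _ := [isSub for GL2val].
HB.instance Definition _ := [Choice of GL2 by <:].

Implicit Types A B C : GL2.

Definition GL2mul A B : GL2 :=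
  MkGL2 (introT idP (etrans (unitrMr _ (GL2P A)) (GL2P B))).
Definition GL2inv A : GL2 := MkGL2 (etrans (unitrV _) (GL2P A)).

Lemma GL2mulA : associative GL2mul.
Proof. by move=> A B C; apply: val_inj; rewrite /= mulrA. Qed.
Lemma GL2mul1 : left_id (MkGL2 (unitr1 _)) GL2mul.
Proof. by move=> A; apply: val_inj; rewrite /= mul1r. Qed.
Lemma GL2mulr1 : right_id (MkGL2 (unitr1 _)) GL2mul.
Proof. by move=> A; apply: val_inj; rewrite /= mulr1. Qed.
Lemma GL2mulV : left_inverse (MkGL2 (unitr1 _)) GL2inv GL2mul.
Proof. by move=> A; apply: val_inj; rewrite /= mulVr ?GL2P. Qed.
Lemma GL2mulrV : right_inverse (MkGL2 (unitr1 _)) GL2inv GL2mul.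
Proof. by move=> A; apply: val_inj; rewrite /= divrr ?GL2P. Qed.

HB.instance Definition _ :=
  isGroup.Build GL2 GL2mulA GL2mul1 GL2mulr1 GL2mulV GL2mulrV.

Lemma GL2valM A B : (A * B)%g = GL2val A * GL2val B :> 'M_2.
Proof. by []. Qed.
Lemma GL2valV A : (A^-1)%g = (GL2val A)^-1 :> 'M_2. Proof. by []. Qed.

Definition projeq A B : bool := is_scalar_mx (GL2val (A * B^-1)%g).

Lemma projeqP A B : reflect (exists2 c : K, c != 0 & val A = c *: val B)
                            (projeq A B).
Proof.
apply: (iffP is_scalar_mxP) => -[c].
  rewrite GL2valM GL2valV => /(canRL (mulrVK (GL2P B))) e; exists c.
    apply: contraTneq (GL2P A) => c0.
    by rewrite e c0 raddf0 mul0r unitr0.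
  by rewrite [LHS]e; apply: mul_scalar_mx.
move=> c0 e; exists c; rewrite GL2valM GL2valV [GL2val A]e.
by rewrite -scalerAl divrr ?GL2P // scalemx1.
Qed.

Lemma projeq_refl : reflexive projeq.
Proof. by move=> A; apply/projeqP; exists 1; rewrite ?oner_eq0 ?scale1r. Qed.
Lemma projeq_sym : symmetric projeq.
Proof.
have half A B : projeq A B -> projeq B A.
  move=> /projeqP[c c0 e]; apply/projeqP; exists c^-1; rewrite ?invr_eq0 //.
  by rewrite e scalerA mulVf // scale1r.
by move=> A B; apply/idP/idP; apply: half.
Qed.
Lemma projeq_trans : transitive projeq.
Proof.
move=> B A C /projeqP[c c0 e] /projeqP[d d0 f]; apply/projeqP.
by exists (c * d); rewrite ?mulf_neq0 // e f scalerA.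
Qed.

Canonical projeq_equiv :=
  EquivRel projeq projeq_refl projeq_sym projeq_trans.

Definition PGL2 := {eq_quot projeq}.
HB.instance Definition _ : EqQuotient _ projeq PGL2 := EqQuotient.on PGL2.
HB.instance Definition _ := Choice.on PGL2.

Implicit Types f g h : PGL2.

Definition PGL2mul := lift_op2 PGL2 (fun A B : GL2 => (A * B)%g).
Lemma pi_PGL2mul : {morph \pi : A B / (A * B)%g >-> PGL2mul A B}.
Proof.
move=> A B; unlock PGL2mul; apply/eqmodP; apply/projeqP.
have /eqmodP/projeqP[c c0 e] : A = generic_quotient.repr (\pi_PGL2 A)
  %[mod PGL2] by rewrite reprK.
have /eqmodP/projeqP[d d0 f] : B = generic_quotient.repr (\pi_PGL2 B)
  %[mod PGL2] by rewrite reprK.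
exists (c * d); rewrite ?mulf_neq0 // [LHS]GL2valM [GL2val A]e [GL2val B]f.
by rewrite -scalerAl -scalerAr scalerA.
Qed.
Canonical pi_PGL2mul_morph := PiMorph2 pi_PGL2mul.

Definition PGL2inv := lift_op1 PGL2 (fun A : GL2 => (A^-1)%g).
Lemma pi_PGL2inv : {morph \pi : A / (A^-1)%g >-> PGL2inv A}.
Proof.
move=> A; unlock PGL2inv; apply/eqmodP; apply/projeqP.
have /eqmodP/projeqP[c c0 e] : A = generic_quotient.repr (\pi_PGL2 A)
  %[mod PGL2] by rewrite reprK.
exists c^-1; rewrite ?invr_eq0 // [LHS]GL2valV [GL2val A]e.
by rewrite invrZ ?unitfE ?GL2P.
Qed.
Canonical pi_PGL2inv_morph := PiMorph1 pi_PGL2inv.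

Definition PGL2one : PGL2 := lift_cst PGL2 1%g.
Canonical pi_PGL2one_morph := PiConst PGL2one.

Lemma PGL2mulA : associative PGL2mul.
Proof.
by elim/quotW=> A; elim/quotW=> B; elim/quotW=> C; rewrite !piE mulgA.
Qed.
Lemma PGL2mul1 : left_id PGL2one PGL2mul.
Proof. by elim/quotW=> A; rewrite !piE mul1g. Qed.
Lemma PGL2mulr1 : right_id PGL2one PGL2mul.
Proof. by elim/quotW=> A; rewrite !piE mulg1. Qed.
Lemma PGL2mulV : left_inverse PGL2one PGL2inv PGL2mul.
Proof. by elim/quotW=> A; rewrite !piE mulVg. Qed.
Lemma PGL2mulrV : right_inverse PGL2one PGL2inv PGL2mul.
Proof. by elim/quotW=> A; rewrite !piE mulgV. Qed.

HB.instance Definition _ :=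
  isGroup.Build PGL2 PGL2mulA PGL2mul1 PGL2mulr1 PGL2mulV PGL2mulrV.

(* [x : y] |-> [a x + b y : c x + d y] for A = (a, b; c, d). *)
Definition mobius_mx (A : 'M[K]_2) (P : P1 K) : P1 K :=
  let: (x, y) := if P is Some x then (x, 1) else (1, 0) in
  let u := A 0 0 * x + A 0 1 * y in
  let v := A 1 0 * x + A 1 1 * y in
  if v == 0 then None else Some (u / v).

Definition mobius f : P1 K -> P1 K := mobius_mx (val (generic_quotient.repr f)).

Lemma mobius_pi A : mobius (\pi A) =1 mobius_mx (val A).
Proof.
move=> P; rewrite /mobius.
have /eqmodP/projeqP[c c0 ->] : A = generic_quotient.repr (\pi_PGL2 A)
  %[mod PGL2] by rewrite reprK.
rewrite /mobius_mx; set M := val _.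
by case: P => [x|]; rewrite !mxE -!mulrA -!mulrDr mulf_eq0 (negPf c0) /=;
  rewrite -mulf_div divff // mul1r.
Qed.

End PGL2.

(* The self-map of P^1(Qbar) induced by phi; algC is an algebraic closure
   of the rationals. *)
Definition ratmapC (phi : {fraction {poly rat}}) : P1 algC -> P1 algC :=
  P1_eval (map_poly ratr (numer phi)) (map_poly ratr (denom phi)).

(* f^-1 o phi o f = phi, as self-maps of P^1(Qbar). *)
Definition in_Aut (phi : {fraction {poly rat}}) (f : PGL2 algC) : Prop :=
  mobius (f^-1)%g \o ratmapC phi \o mobius f =1 ratmapC phi.

(* The subgroup {x | H x} of G is isomorphic to the group C. *)
Definition subgroup_isog (C G : groupType) (H : G -> Prop) : Prop :=
  exists h : {multiplicative C -> G},
    injective h /\ forall x : G, H x <-> exists c : C, h c = x.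

(* The additive group 'Z_2 is the cyclic group of order 2. *)
Definition Aut_isog_C2 (phi : {fraction {poly rat}}) : Prop :=
  @subgroup_isog 'Z_2 (PGL2 algC) (in_Aut phi).

Definition has_exact_period (T : Type) (F : T -> T) (n : nat) (P : T) : Prop :=
  [/\ (0 < n)%N, iter n F P = P
    & forall m : nat, (0 < m < n)%N -> iter m F P <> P].

Definition periodic (T : Type) (F : T -> T) (P : T) : Prop :=
  exists2 n : nat, (0 < n)%N & iter n F P = P.

(* Periodic points are finite: hence the point [Some x]. *)
Definition Manes_conjecture : Prop :=
  forall phi : {fraction {poly rat}},
    rat_degree phi = 2 -> Aut_isog_C2 phi ->
    forall (N : nat) (x : rat), (4 < N)%N ->
      ~ has_exact_period (ratmap phi) N (Some x).

Definition phi_ (t1 t2 : rat) : {fraction {poly rat}} :=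
  let z := FracField.tofrac 'X in
  FracField.tofrac t1%:P * z + FracField.tofrac t2%:P / z.

(* Main.v *)
Require Import Defs.
From mathcomp Require Import all_boot all_order all_algebra fraction.
From mathcomp Require Import classical_sets cardinality.
From mathcomp Require Import ring lra zify.

Import Order.TTheory GRing.Theory Num.Theory.
Local Open Scope ring_scope.
Local Open Scope classical_set_scope.

(** If z is a periodic point of t1 z + t2 / z, then s = t1 z^2 / t2 is a periodic
    point of s |-> T (s + 1)^2 / s with T = t1^2, a map not depending on t2.

    Where T is large, at an archimedean or p-adic place, its finite cycles lie
    close to s = -1.  When a and b are both periodic, the corresponding points of
    the s-line have the fixed ratio b^2 / a^2; if this is not 1, then t1 is
    bounded at the archimedean place and has bounded denominator, so that it
    takes finitely many values.  For each of them, Northcott's argument leaves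
    finitely many rational periodic points s = t1 a^2 / t2, hence finitely many
    t2.  Conversely, a and -a are both fixed as soon as t1 a^2 + t2 = a^2. *)

(** * Lowest terms and the action on the projective line *)

Lemma tofrac_numden (R : idomainType) (x : {fraction R}) :
  x * FracField.tofrac \d_(generic_quotient.repr x) =
  FracField.tofrac \n_(generic_quotient.repr x).
Proof.
elim/generic_quotient.quotW: x => x; set r := generic_quotient.repr _.
have := FracField.equivf_l x; rewrite -/r => e.
rewrite !generic_quotient.piE; apply/generic_quotient.eqmodP.
rewrite /= FracField.equivfE /FracField.mulf !numden_Ratio ?mulr1 ?mul1r
  ?oner_neq0 ?mulf_neq0 ?denom_ratioP //.
by apply/eqP; rewrite mulrC -e mulrC.
Qed.

(** As [t2] is nonzero, [t1 *: 'X^2 + t2%:P] is coprime to ['X]; two reduced forms of one fraction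
    differ by a constant [k], which depends on the chosen representative. *)
Lemma phi_numer_denom (t1 t2 : rat) : t2 != 0 ->
  exists2 k : rat, k != 0 &
    numer (phi_ t1 t2) = k *: (t1 *: 'X^2 + t2%:P) /\
    denom (phi_ t1 t2) = k *: 'X.
Proof.
move=> t20; rewrite /numer /denom; have := tofrac_numden _ (phi_ t1 t2).
set r := generic_quotient.repr _; set n := \n_r; set d := \d_r => h.
have d0 : d != 0 by apply: denom_ratioP.
set q : {poly rat} := t1 *: 'X^2 + t2%:P.
have e : n * 'X = d * q.
  have X0 : FracField.tofrac ('X : {poly rat}) != 0
    by rewrite tofrac_eq0 polyX_eq0.
  apply/eqP; rewrite -tofrac_eq !tofracM; apply/eqP.
  rewrite -h /phi_ /q tofracD -mul_polyC tofracM tofracXn.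
  by rewrite mulrAC mulrDl divfK // -mulrA -expr2 mulrC.
have g0 : gcdp n d != 0 by rewrite gcdp_eq0 negb_and d0 orbT.
set N := n %/ gcdp n d; set D := d %/ gcdp n d.
have nE : n = N * gcdp n d by rewrite divpK ?dvdp_gcdl.
have dE : d = D * gcdp n d by rewrite divpK ?dvdp_gcdr.
have cND : coprimep N D by apply: coprimep_div_gcd; rewrite d0 orbT.
have {}e : N * 'X = D * q.
  by apply: (mulIf g0); rewrite mulrAC -nE e {1}dE mulrAC.
have D0 : D != 0 by apply: contra_neq d0 => D0; rewrite dE D0 mul0r.
have cXq : coprimep 'X q.
  by rewrite coprimep_sym coprimepX rootE /q !hornerE /= !mulr0 add0r.
have XD : 'X %| D by rewrite -(Gauss_dvdpl _ cXq) -e dvdp_mull.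
have DX : D %| 'X.
  by rewrite -(Gauss_dvdpr _ (_ : coprimep D N)) 1?coprimep_sym // e dvdp_mulr.
have /eqpP[[c1 c2] /= /andP[c10 c20] DE] : D %= 'X by rewrite /eqp DX XD.
have {}DE : D = (c2 / c1) *: 'X.
  by rewrite mulrC -scalerA -DE scalerA mulVf // scale1r.
exists (c2 / c1); first by rewrite mulf_neq0 ?invr_eq0.
split=> //; apply: (@mulIf _ 'X); first by rewrite polyX_eq0.
by rewrite e DE -!scalerAl ['X * q]mulrC.
Qed.

Lemma ratmap_phi (t1 t2 : rat) : t1 != 0 -> t2 != 0 -> forall P : P1 rat,
  ratmap (phi_ t1 t2) P =
    if P is Some z then if z == 0 then None else Some (t1 * z + t2 / z)
    else None.
Proof.
move=> t10 t20 P; rewrite /ratmap.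
have [k k0 [-> ->]] := phi_numer_denom t1 t2 t20.
have sz : size (t1 *: 'X^2 + t2%:P : {poly rat}) = 3.
  rewrite size_polyDl size_scale ?size_polyXn //.
  by rewrite (leq_ltn_trans (size_polyC_leq1 _)).
rewrite /P1_eval !size_scale // sz size_polyX /=.
case: P => [z|].
  rewrite !hornerE mulf_eq0 (negPf k0) /=; case: eqP => // /eqP z0.
  by congr Some; field; rewrite z0.
(* At infinity the coefficients of degree 2 count, and that of [k *: 'X] is 0. *)
by rewrite !coefZ coefX mulr0 eqxx.
Qed.

(** * Periodic sequences and passage to the s-line *)

(** Once above [B], the sequence would increase strictly forever and never return to its starting
    value. This serves for heights, p-adic valuations and absolute values. *)
Lemma periodic_le d (R : orderType d) (u : nat -> R) (n : nat) (B : R) :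
  (0 < n)%N -> (forall i, u (n + i)%N = u i) ->
  (forall i, (B < u i)%O -> (u i < u i.+1)%O) -> forall i, (u i <= B)%O.
Proof.
move=> n0 per incr i; rewrite leNgt; apply/negP => Bi.
have grow m : (B < u (m + i)%N)%O && (u i <= u (m + i)%N)%O.
  elim: m => [|m /andP[Bm im]]; first by rewrite add0n Bi lexx.
  have := incr _ Bm; rewrite addSn => lt_m.
  by rewrite (lt_trans Bm lt_m) (le_trans im (ltW lt_m)).
case: n n0 per => // n _ per.
have /andP[Bm im] := grow n; have := incr _ Bm.
by rewrite -addSn per ltNge im.
Qed.

(* The cycle condition for the self-map s |-> T (s + 1)^2 / s. *)
Definition is_cycle (T : rat) (n : nat) (u : nat -> rat) : Prop :=
  [/\ (0 < n)%N, forall i, u (n + i)%N = u i, forall i, u i != 0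
    & forall i, u i * u i.+1 = T * (u i + 1) ^+ 2].

Lemma periodic_is_cycle {t1 t2 z : rat} : t1 != 0 -> t2 != 0 ->
  periodic (ratmap (phi_ t1 t2)) (Some z) ->
  exists n u, is_cycle (t1 ^+ 2) n u /\ u 0%N = t1 * z ^+ 2 / t2.
Proof.
move=> t10 t20 [n n0 per].
have ratE := ratmap_phi t1 t2 t10 t20.
set F := ratmap _ in per ratE.
(* Infinity is fixed, so an orbit reaching it at time [i] would still be there at time [i * n], when
   it is back at [z]. *)
have finite i : iter i F (Some z) <> None.
  have absorb m : iter m F None = None by elim: m => //= m ->; rewrite ratE.
  have perk k : iter (k * n) F (Some z) = Some z.
    by elim: k => // k IH; rewrite mulSn iterD IH.
  move=> iN; have le_i : (i <= i * n)%N by rewrite leq_pmulr.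
  by move: (perk i); rewrite -(subnK le_i) iterD iN absorb.
pose y i := odflt 0 (iter i F (Some z)).
have yE i : iter i F (Some z) = Some (y i).
  by rewrite /y; move: (finite i); case: (iter _ _ _).
have y0 i : y i != 0.
  by apply/eqP => yi; apply: (finite i.+1); rewrite iterS yE ratE yi eqxx.
have yS i : y i.+1 = t1 * y i + t2 / y i.
  by apply: Some_inj; rewrite -yE iterS yE ratE (negPf (y0 i)).
exists n, (fun i => t1 * y i ^+ 2 / t2); split=> //; split=> // i.
- by congr (_ * _ ^+ 2 / _); apply: Some_inj; rewrite -!yE addnC iterD per.
- by rewrite !mulf_neq0 ?invr_eq0 ?expf_neq0.
by rewrite yS; field; rewrite ?y0 ?t10 ?t20.
Qed.

(** * Heights and p-adic behaviour of a cycle *)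

(** Let [b <= a]. If [a <= 4 * b], then [a ^ 2 <= 4 * (a * b)]; otherwise [a <= c + b] forces
    [3 * a <= 4 * c]. *)
Lemma maxn_sq_le (a b c B : nat) : (a <= c + b -> b <= c + a ->
  c ^ 2 <= B -> a * b <= B -> maxn a b ^ 2 <= 4 * B)%N.
Proof.
wlog ba : a b / (b <= a)%N => [hw|].
  case/orP: (leq_total b a) => [/hw //|/hw h] ab ba cB abB.
  by rewrite maxnC; apply: h => //; rewrite mulnC.
move=> ab _ cB abB; rewrite (maxn_idPl ba) -mulnn.
case: (leqP a (4 * b)) => h; first by nia.
have : (3 * a <= 4 * c)%N by lia.
move: cB; rewrite -mulnn; nia.
Qed.

Section Cycle.
Variables (t : rat) (n : nat) (u : nat -> rat).
Hypotheses (t0 : t != 0) (cyc : is_cycle (t ^+ 2) n u).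

Let r := `|numq t|%N.
Let s := `|denq t|%N.
Let x i := `|numq (u i)|%N.
Let y i := `|denq (u i)|%N.
(** Up to sign, the numerator of [u i + 1] in lowest terms. *)
Let w i := `|(numq (u i) + denq (u i))%R|%N.

Lemma cycle_gt0 i : [/\ (0 < x i)%N, (0 < y i)%N, (0 < r)%N & (0 < s)%N].
Proof.
case: cyc => _ _ u0 _.
by rewrite !absz_gt0 !numq_eq0 !denq_neq0 u0 t0.
Qed.

Lemma cycle_eqn i : (x i.+1 * s ^ 2 * (x i * y i) = y i.+1 * r ^ 2 * w i ^ 2)%N.
Proof.
case: cyc => _ _ _ /(_ i) e.
have : numq (u i.+1) * denq t ^+ 2 * (numq (u i) * denq (u i)) =
  denq (u i.+1) * numq t ^+ 2 * (numq (u i) + denq (u i)) ^+ 2.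
  apply: (@intr_inj rat); rewrite !(rmorphM, rmorphXn, rmorphD) /= !numqE.
  set D := (denq (u i.+1))%:~R; set E := (denq t)%:~R; set G := (denq (u i))%:~R.
  transitivity (u i * u i.+1 * (D * E ^+ 2 * G ^+ 2)); first by ring.
  by rewrite e; ring.
by move/(congr1 absz); rewrite !(abszX, abszM).
Qed.

Lemma coprime_cycle i :
  [/\ coprime (x i) (y i), coprime (w i) (x i) & coprime (w i) (y i)].
Proof.
have xy : coprime (x i) (y i) := coprime_num_den (u i).
split=> //; rewrite coprime_sym -coprimezE.
  by rewrite /coprimez gcdzDl -/(coprimez _ _).
by rewrite /coprimez addrC gcdzDl gcdzC -/(coprimez _ _).
Qed.

(** In [cycle_eqn], [w i] is coprime to [x i * y i], so little cancels: the height H of [u i] and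
    the next height H' satisfy H^2 <= 4 r^2 s^2 H'. Above the bound, heights would grow forever. *)
Lemma cycle_height i : (maxn (x i) (y i) <= 4 * (r ^ 2 * s ^ 2))%N.
Proof.
case: (cyc) => n0 per _ _; move: i.
apply: (periodic_le _ _ (fun i => maxn (x i) (y i)) n) => // [i|i].
  by rewrite /x /y per.
rewrite !ltEnat /=.
have [xy wx wy] := coprime_cycle i; have [x0 y0 r0 s0] := cycle_gt0 i.
have [x0' y0' _ _] := cycle_gt0 i.+1; have e := cycle_eqn i.
have cw : coprime (w i ^ 2) (x i * y i) by rewrite coprimeMr !coprimeXl.
have le_w : (w i ^ 2 <= x i.+1 * s ^ 2)%N.
  apply: dvdn_leq; first by rewrite muln_gt0 x0' expn_gt0 s0.
  by rewrite -(Gauss_dvdl _ cw) e dvdn_mull.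
have le_xy : (x i * y i <= y i.+1 * r ^ 2)%N.
  apply: dvdn_leq; first by rewrite muln_gt0 y0' expn_gt0 r0.
  by rewrite coprime_sym in cw; rewrite -(Gauss_dvdl _ cw) -e dvdn_mull.
have [xw yw] : (x i <= w i + y i)%N /\ (y i <= w i + x i)%N
  by rewrite /x /y /w; lia.
set H' := maxn (x i.+1) _; set C := (r ^ 2 * s ^ 2)%N.
have [xH' yH'] : (x i.+1 <= H')%N /\ (y i.+1 <= H')%N
  by rewrite leq_maxl leq_maxr.
have le_H : (maxn (x i) (y i) ^ 2 <= 4 * (H' * C))%N.
  apply: (maxn_sq_le _ _ (w i)) => //.
    by rewrite (leq_trans le_w) // leq_mul // leq_pmull // expn_gt0 r0.
  by rewrite (leq_trans le_xy) // leq_mul // leq_pmulr // expn_gt0 s0.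
move=> ltH; rewrite ltnNge; apply/negP => leH.
have : (4 * (H' * C) <= maxn (x i) (y i) * (4 * C))%N.
  by rewrite mulnCA leq_mul.
move/(leq_trans le_H); rewrite -mulnn leq_pmul2l; last by rewrite leq_max x0.
by rewrite leqNgt ltH.
Qed.

Lemma logn_cycle (p i : nat) :
  (logn p (x i.+1) + (logn p s).*2 + (logn p (x i) + logn p (y i)) =
   logn p (y i.+1) + (logn p r).*2 + (logn p (w i)).*2)%N.
Proof.
have [x0 y0 r0 s0] := cycle_gt0 i; have [x0' y0' _ _] := cycle_gt0 i.+1.
have e := cycle_eqn i.
(* The cycle avoids -1, whose image is 0. *)
have w0 : (0 < w i)%N.
  have : (0 < x i.+1 * s ^ 2 * (x i * y i))%N
    by rewrite !muln_gt0 x0' x0 y0 s0.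
  by rewrite e muln_gt0 expn_gt0 orbF => /andP[_].
move/(congr1 (logn p)): e.
by rewrite !lognM ?muln_gt0 ?x0 ?y0 ?r0 ?s0 ?x0' ?y0' ?w0 // !addnn.
Qed.

(* At a prime p dividing s = denq t, infinity is attracting: once p divides the
   denominator of a point, its multiplicity there increases forever; and if p
   divides the numerator, it divides the denominator of the next point. *)
Lemma coprime_denq_cycle i : coprime s (x i * y i).
Proof.
case: (cyc) => n0 per _ _; have [_ _ _ s0] := cycle_gt0 0.
have rs : coprime s r by rewrite coprime_sym; exact: coprime_num_den.
have logn0 p a b : coprime a b -> (p %| a)%N -> logn p b = 0%N.
  by move=> ab pa; apply: logn_coprime; apply: coprime_dvdl pa ab.
have lognP p m : (0 < m)%N -> prime p -> (0 < logn p m)%N = (p %| m)%N.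
  by move=> m0 pp; rewrite logn_gt0 mem_primes pp m0.
have notdvd p : prime p -> (p %| s)%N -> forall j, ~~ (p %| x j * y j)%N.
  move=> pp ps; have lr := logn0 _ _ _ rs ps.
  have ls : (0 < logn p s)%N by rewrite lognP.
  have ly j : (logn p (y j) <= 0)%N.
    move: j; apply: (periodic_le _ _ (fun j => logn p (y j)) n) => // [j|j].
      by rewrite /y per.
    rewrite !ltEnat /= => lyj; have [_ yj0 _ _] := cycle_gt0 j.
    have [xy _ wy] := coprime_cycle j.
    have pyj : (p %| y j)%N by rewrite -lognP.
    have := logn_cycle p j; rewrite lr.
    rewrite (logn0 _ _ (x j) _ pyj) 1?coprime_sym //.
    rewrite (logn0 _ _ (w j) _ pyj) 1?coprime_sym //; lia.
  move=> j; have [xj0 yj0 _ _] := cycle_gt0 j; rewrite Euclid_dvdM // negb_or.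
  rewrite -!lognP // -!leqNgt ly andbT leqNgt; apply/negP => lxj.
  have [xy wx _] := coprime_cycle j.
  have pxj : (p %| x j)%N by rewrite -lognP.
  have := logn_cycle p j; rewrite lr.
  rewrite (logn0 _ _ (w j) _ pxj) 1?coprime_sym //.
  have := ly j.+1; lia.
have [x0 y0 _ _] := cycle_gt0 i.
rewrite coprime_has_primes ?muln_gt0 ?x0 //; apply/hasPn => p.
rewrite !mem_primes /= => /and3P[pp _ pxy]; apply/negP => /and3P[_ _ ps].
by have := notdvd p pp ps i; rewrite pxy.
Qed.

(** This is p-adic closeness to -1: in [cycle_eqn], [s ^ 2] is coprime to [y i.+1 * r ^ 2], so it
    divides [w i ^ 2]. *)
Lemma denq_dvd_cycle i : (s %| w i)%N.
Proof.
have rs : coprime s r by rewrite coprime_sym; exact: coprime_num_den.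
have /andP[_ sy'] : coprime s (x i.+1) && coprime s (y i.+1)
  by rewrite -coprimeMr coprime_denq_cycle.
rewrite -(@dvdn_pexp2r _ _ 2) //.
have c2 : coprime (s ^ 2) (y i.+1 * r ^ 2)
  by rewrite coprimeXl // coprimeMr sy' coprimeXr.
by rewrite -(Gauss_dvdr _ c2) -cycle_eqn mulnAC dvdn_mull.
Qed.

End Cycle.

(** * Bounds on t from two cycles *)

(** If |u| > 2, then |u + 1| > |u| / 2, and the next point has absolute value above 16 |u| / 4.
    Hence cycles stay in |u| <= 2, and t^2 |u + 1|^2 is a product of two such absolute values. *)
Lemma cycle_near_opp1 (t : rat) (n : nat) (u : nat -> rat) :
  is_cycle (t ^+ 2) n u -> 4 <= `|t| -> forall i, `|t| * `|u i + 1| <= 2.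
Proof.
move=> [n0 per u0 e] t4.
have u2 : forall i, `|u i| <= 2.
  apply: (periodic_le _ _ (fun i => `|u i|) n) => // [i|i u2].
    by rewrite per.
  have ui : 0 < `|u i| by rewrite normr_gt0.
  have le_u := lerB_normD (u i) 1; rewrite normr1 in le_u.
  have := congr1 Num.norm (e i); rewrite !normrM => ee.
  rewrite -(ltr_pM2l ui) ee; set U := `|u i| in ee le_u ui u2 *.
  have h1 : 16 <= `|t| ^+ 2 by nra.
  have h2 : U ^+ 2 / 4 < `|u i + 1| ^+ 2 by nra.
  nra.
move=> i; rewrite -ler_sqr ?nnegrE ?mulr_ge0 // exprMn -!normrX -normrM -e normrM.
have := u2 i; have := u2 i.+1.
have := normr_ge0 (u i); have := normr_ge0 (u i.+1); nra.
Qed.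

(** If |t| >= 4, both points lie within 2 / |t| <= 1/2 of -1. So |U| >= 1/2, while |l - 1| |U| = |V
    - U| <= 4 / |t|. *)
Lemma ratio_cycles_bound {t l : rat} {m n : nat} {u v : nat -> rat} :
  is_cycle (t ^+ 2) m u -> is_cycle (t ^+ 2) n v ->
  v 0%N = l * u 0%N -> l != 1 -> `|t| <= 4 + 8 / `|l - 1|.
Proof.
move=> cu cv vu l1; have l10 : 0 < `|l - 1| by rewrite normr_gt0 subr_eq0.
have [t4|/ltW t4] := leP `|t| 4.
  by rewrite (le_trans t4) // lerDl divr_ge0.
have hu := cycle_near_opp1 _ _ _ cu t4 0.
have hv := cycle_near_opp1 _ _ _ cv t4 0.
set U := u 0%N in vu hu *; set V := v 0%N in vu hv *.
have U1 : 1 / 2 <= `|U|.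
  have : 1 - `|U + 1| <= `|U|.
    by have := ler_normB (U + 1) U; rewrite addrAC subrr add0r normr1; lra.
  have := normr_ge0 (U + 1); nra.
have le4 : `|t| * (`|l - 1| * `|U|) <= 4.
  rewrite -normrM.
  have -> : (l - 1) * U = (V + 1) - (U + 1) by rewrite vu; ring.
  by have := ler_normB (V + 1) (U + 1); nra.
rewrite ler_wpDl // ler_pdivlMr //.
nra.
Qed.

(** Both starting points are -1 modulo [denq t], so their ratio [l] is 1 modulo [denq t]. *)
Lemma ratio_cycles_denq {t l : rat} {m n : nat} {u v : nat -> rat} : t != 0 ->
  is_cycle (t ^+ 2) m u -> is_cycle (t ^+ 2) n v ->
  v 0%N = l * u 0%N -> (denq t %| numq l - denq l)%Z.
Proof.
move=> t0 cu cv vu.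
have du := denq_dvd_cycle _ _ _ t0 cu 0.
have dv := denq_dvd_cycle _ _ _ t0 cv 0.
have := coprime_denq_cycle _ _ _ t0 cu 0.
have := coprime_denq_cycle _ _ _ t0 cv 0.
rewrite !coprimeMr => /andP[_ cV] /andP[_ cU].
have e : (numq l - denq l) * (denq (u 0%N) * denq (v 0%N)) =
  numq l * denq (v 0%N) * (numq (u 0%N) + denq (u 0%N)) -
  denq l * denq (u 0%N) * (numq (v 0%N) + denq (v 0%N)).
  apply: (@intr_inj rat); rewrite !(rmorphM, rmorphD, rmorphN) /= !numqE vu; ring.
have c : coprimez (denq t) (denq (u 0%N) * denq (v 0%N)).
  by rewrite coprimezMr; apply/andP.
by rewrite -(Gauss_dvdzl _ c) e rpredB ?dvdz_mull.
Qed.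

(** * Finiteness, and the infinite family *)

Lemma finite_rat_bounded (K : nat) :
  finite_set [set q : rat | (`|numq q| <= K)%N /\ (`|denq q| <= K)%N].
Proof.
pose f (p : 'I_K.+1 * 'I_K.+1 * bool) : rat := (-1) ^+ p.2 * p.1.1%:R / p.1.2%:R.
apply: (@sub_finite_set _ _
  [set f p | p in [set: 'I_K.+1 * 'I_K.+1 * bool]]); last first.
  by apply: finite_image; apply: finite_finset.
move=> q [/= hn hd].
exists (Ordinal (hn : (_ < K.+1)%N), Ordinal (hd : (_ < K.+1)%N),
  (numq q < 0)) => //.
rewrite /f /= -[RHS]divq_num_den; congr (_ / _).
  by rewrite [in RHS](intEsign (numq q)) rmorphM rmorphXn /= rmorphN1.
by rewrite -[in RHS](gez0_abs (denq_ge0 q)).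
Qed.

Lemma finite_common_periodic (a b : rat) :
  a != 0 -> a ^+ 2 != b ^+ 2 ->
  finite_set [set t : rat * rat |
      [/\ t.1 != 0, t.2 != 0,
          periodic (ratmap (phi_ t.1 t.2)) (Some a)
        & periodic (ratmap (phi_ t.1 t.2)) (Some b)]].
Proof.
move=> a0 ab; pose l := b ^+ 2 / a ^+ 2.
have a20 : a ^+ 2 != 0 by rewrite expf_neq0.
have l1 : l != 1.
  by apply: contra_neq ab => /(canRL (divfK a20)) ->; rewrite mul1r.
pose S := absz (numq l - denq l).
have S0 : (0 < S)%N.
  rewrite absz_gt0 subr_eq0; apply: contra_neq l1 => e.
  by rewrite -[l]divq_num_den e divff // intr_eq0 denq_neq0.
(* [S] bounds [denq t1], [N] bounds the numerator [t1 * denq t1], and the last term of [K] bounds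
   the height of the cycle. *)
pose N := Num.bound ((4 + 8 / `|l - 1|) * S%:R).
pose K := (N + S + 4 * (N ^ 2 * S ^ 2))%N.
pose Q := [set q : rat | (`|numq q| <= K)%N /\ (`|denq q| <= K)%N].
(* The pair of [t1] and s = t1 a^2 / t2 determines t2 = t1 a^2 / s. *)
apply: (@sub_finite_set _ _ [set (p.1, p.1 * a ^+ 2 / p.2) | p in Q `*` Q]).
  move=> [t1 t2] /= [t10 t20 /(periodic_is_cycle t10 t20)[m [u [cu u0]]]].
  move=> /(periodic_is_cycle t10 t20)[n [v [cv v0]]].
  have vu : v 0%N = l * u 0%N by rewrite v0 u0 /l; field; rewrite a0 t20.
  have sS : (`|denq t1| <= S)%N.
    exact: dvdn_leq S0 (ratio_cycles_denq t10 cu cv vu).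
  have rN : (`|numq t1| <= N)%N.
    apply: ltnW; rewrite -(ltr_nat rat) natr_absz intr_norm numqE normrM.
    rewrite -intr_norm -natr_absz.
    have B0 : 0 <= 4 + 8 / `|l - 1| by rewrite addr_ge0 ?divr_ge0.
    apply: le_lt_trans (archi_boundP _); last by rewrite mulr_ge0.
    by rewrite ler_pM ?ler_nat // (ratio_cycles_bound cu cv vu l1).
  have := cycle_height _ _ _ t10 cu 0; rewrite geq_max => /andP[xK yK].
  have rsK : (4 * (`|numq t1| ^ 2 * `|denq t1| ^ 2) <= K)%N.
    by rewrite (leq_trans _ (leq_addl _ _)) // leq_mul // leq_mul // leq_sqr.
  exists (t1, u 0%N) => /=; first split; rewrite /Q /=.
  - rewrite /K; lia.
  - by rewrite !(leq_trans _ rsK).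
  by congr pair; rewrite u0; field; rewrite ?a0 ?t10 ?t20.
by apply: finite_image; apply: finite_setX; apply: finite_rat_bounded.
Qed.

Theorem theorem4p5 :
  Manes_conjecture ->
  forall a b : rat, a != 0 -> b != 0 ->
    infinite_set [set t : rat * rat |
      [/\ t.1 != 0, t.2 != 0,
          periodic (ratmap (phi_ t.1 t.2)) (Some a)
        & periodic (ratmap (phi_ t.1 t.2)) (Some b)]]
    <-> a ^+ 2 = b ^+ 2.
Proof.
move=> _ a b a0 b0; split=> [inf|ab].
  by apply/eqP; apply: contra_notT inf; apply: finite_common_periodic.
(* These parameters solve t1 a^2 + t2 = a^2; starting [t1] at 2 keeps [t2] nonzero. *)
have fixed (k : nat) (z : rat) : z != 0 -> z ^+ 2 = a ^+ 2 ->
    periodic (ratmap (phi_ k.+2%:R (- k.+1%:R * a ^+ 2))) (Some z).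
  move=> z0 za; exists 1%N => //=.
  rewrite ratmap_phi ?mulf_neq0 ?oppr_eq0 ?expf_neq0 ?pnatr_eq0 //.
  by rewrite (negPf z0) -za; congr Some; rewrite -[k.+2%:R]natr1; field.
pose f (k : nat) : rat * rat := (k.+2%:R, - k.+1%:R * a ^+ 2).
have f_inj : injective f by move=> j k [] /eqP; rewrite eqr_nat => /eqP [].
move=> /(finite_preimage (in2W f_inj)) fin; apply: infinite_nat.
apply: sub_finite_set fin => k _ /=.
by split; rewrite ?mulf_neq0 ?oppr_eq0 ?expf_neq0 ?pnatr_eq0 //; exact: fixed.
Qed.
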